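(* Let $r$ be a positive integer, $k\in\mathbb Z$, and $a_1,\dots,a_r$ nonzero complex numbers. Then for every integer $n\ge 0$, \begin{align*} S_n^{(r,k)}(x|a_1,\dots,a_r)&=\sum_{l=0}^n\binom{n}{l}B_{n-l}(a_1,\dots,a_r)B_l^{(k)}(x)\\ &=\sum_{l=0}^n\binom{n}{l}B_{n-l}^{(k)}B_l(x|a_1,\dots,a_r)\\ &=\sum_{l=0}^n\sum_{m=0}^n\sum_{j=0}^m(-1)^j\binom{m}{j}\binom{n}{l}\frac{1}{(m+1)^k}B_{n-l}(a_1,\dots,a_r)(x-j)^l\\ &=\sum_{l=0}^n\left(\sum_{j=l}^n\sum_{m=0}^{n-j}(-1)^{n-m-j}\binom{n}{j}\binom{j}{l}\frac{m!}{(m+1)^k}S_2(n-j,m)B_{j-l}(a_1,\dots,a_r)\right)x^l\\ &=\sum_{j=0}^n\binom{n}{j}S_{n-j}^{(r,k)}(a_1,\dots,a_r)x^j. \end{align*}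
   Context: For an integer $k$, ${\rm Li}_k(x)=\sum_{m=1}^\infty x^m/m^k$ is the $k$th polylogarithm. For $r\in\mathbb Z_{>0}$, $k\in\mathbb Z$ and nonzero complex $a_1,\dots,a_r$, the Barnes' multiple Bernoulli and poly-Bernoulli mixed-type polynomials $S_n^{(r,k)}(x|a_1,\dots,a_r)$ are defined by $\frac{t^r}{\prod_{j=1}^r(e^{a_jt}-1)}\frac{{\rm Li}_k(1-e^{-t})}{1-e^{-t}}e^{xt}=\sum_{n\ge0}S_n^{(r,k)}(x|a_1,\dots,a_r)\frac{t^n}{n!}$, and $S_n^{(r,k)}(a_1,\dots,a_r):=S_n^{(r,k)}(0|a_1,\dots,a_r)$. The poly-Bernoulli polynomials are defined by $\frac{{\rm Li}_k(1-e^{-t})}{1-e^{-t}}e^{xt}=\sum_{n\ge0}B_n^{(k)}(x)\frac{t^n}{n!}$, with $B_n^{(k)}:=B_n^{(k)}(0)$. The Barnes' multiple Bernoulli polynomials are defined by $\frac{t^r}{\prod_{j=1}^r(e^{a_jt}-1)}e^{xt}=\sum_{n\ge0}B_n(x|a_1,\dots,a_r)\frac{t^n}{n!}$, with $B_n(a_1,\dots,a_r):=B_n(0|a_1,\dots,a_r)$. $S_2(l,m)$ are the Stirling numbers of the second kind: $(e^t-1)^m=m!\sum_{l\ge m}S_2(l,m)\frac{t^l}{l!}$. *)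

(* Defs.v *)
From HB Require Import structures.
From mathcomp Require Import all_boot all_order all_algebra.
From mathcomp Require Import boolp classical_sets reals complex.

Set Implicit Arguments.
Unset Strict Implicit.
Unset Printing Implicit Defensive.

Import Order.TTheory GRing.Theory Num.Theory.
Local Open Scope ring_scope.

(* K[[t]], with [f n] the coefficient of t^n. *)
Record fps (K : Type) := Fps { fcoef :> nat -> K }.

Lemma fpsP (K : Type) (f g : fps K) : (forall n, f n = g n) -> f = g.
Proof. by case: f g => f [g] /= fg; congr Fps; apply/funext. Qed.

HB.instance Definition _ (K : Type) := gen_eqMixin (fps K).
HB.instance Definition _ (K : Type) := gen_choiceMixin (fps K).

Section FpsRing.
Variable K : comNzRingType.
Implicit Types f g h : fps K.

Definition fzero : fps K := Fps (fun=> 0).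
Definition fone : fps K := Fps (fun n => (n == 0%N)%:R).
Definition fopp f : fps K := Fps (fun n => - f n).
Definition fadd f g : fps K := Fps (fun n => f n + g n).
Definition fmul f g : fps K :=
  Fps (fun n => \sum_(i < n.+1) f i * g (n - i)%N).

Let faddA : associative fadd.
Proof. by move=> f g h; apply: fpsP => n /=; rewrite addrA. Qed.
Let faddC : commutative fadd.
Proof. by move=> f g; apply: fpsP => n /=; rewrite addrC. Qed.
Let fadd0 : left_id fzero fadd.
Proof. by move=> f; apply: fpsP => n /=; rewrite add0r. Qed.
Let faddN : left_inverse fzero fopp fadd.
Proof. by move=> f; apply: fpsP => n /=; rewrite addNr. Qed.

HB.instance Definition _ := GRing.isZmodule.Build (fps K) faddA faddC fadd0 faddN.

Definition ftrunc N f : {poly K} := \poly_(i < N) f i.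

Lemma fmul_trunc N f g n : (n < N)%N ->
  fmul f g n = (ftrunc N f * ftrunc N g)`_n.
Proof.
move=> nN; rewrite coefM; apply: eq_bigr => i _.
by rewrite !coef_poly !(leq_ltn_trans _ nN) ?leq_subr // -ltnS.
Qed.

Let fmulC : commutative fmul.
Proof.
by move=> f g; apply: fpsP => n; rewrite !(fmul_trunc _ _ (ltnSn n)) mulrC.
Qed.

Let fmulA : associative fmul.
Proof.
move=> f g h; apply: fpsP => n.
transitivity ((ftrunc n.+1 f * (ftrunc n.+1 g * ftrunc n.+1 h))`_n).
  rewrite coefM; apply: eq_bigr => i _.
  by rewrite coef_poly ltn_ord (@fmul_trunc n.+1) // ltnS leq_subr.
rewrite mulrA coefM; apply: eq_bigr => i _.
by rewrite coef_poly ltnS leq_subr (@fmul_trunc n.+1).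
Qed.

Let fmul1 : left_id fone fmul.
Proof.
move=> f; apply: fpsP => n /=; rewrite big_ord_recl /= mul1r subn0 big1 ?addr0//.
by move=> i _; rewrite mul0r.
Qed.
Let fmulDl : left_distributive fmul fadd.
Proof.
move=> f g h; apply: fpsP => n /=; rewrite -big_split /=.
by apply: eq_bigr => i _; rewrite mulrDl.
Qed.
Let fone_neq0 : fone != 0 :> fps K.
Proof.
by apply/eqP => /(congr1 (fun f : fps K => f 0%N)) /= /eqP; rewrite oner_eq0.
Qed.

HB.instance Definition _ := GRing.Zmodule_isComNzRing.Build (fps K)
  fmulA fmulC fmul1 fmulDl fone_neq0.

(* The indeterminate t. *)
Definition fvar : fps K := Fps (fun n => (n == 1%N)%:R).

(* f(g(t)), meaningful when g(0) = 0, so that (g^m)_n = 0 for m > n. *)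
Definition fcomp f g : fps K :=
  Fps (fun n => \sum_(m < n.+1) f m * (g ^+ m : fps K) n).

(* The quotient f / g when g divides f in K[[t]] (junk value 0 otherwise);
   numerator and denominator may both vanish at t = 0.  It is unique for g != 0
   by [fmulIf]; [barnes_gfP] and [polyB_gfP] show that it exists where it is
   used below. *)
Definition fdiv f g : fps K := xget 0 [set h | h * g = f].

Lemma fcoefD f g n : (f + g) n = f n + g n. Proof. by []. Qed.
Lemma fcoefN f n : (- f) n = - f n. Proof. by []. Qed.
Lemma fcoef0 n : (0 : fps K) n = 0. Proof. by []. Qed.
Lemma fcoef1 n : (1 : fps K) n = (n == 0%N)%:R. Proof. by []. Qed.
Lemma fcoefM f g n : (f * g) n = \sum_(i < n.+1) f i * g (n - i)%N.
Proof. by []. Qed.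

Lemma fcoefM0 f g : (f * g) 0%N = f 0%N * g 0%N.
Proof. by rewrite fcoefM big_ord1. Qed.

Lemma fvar_dvd f : f 0%N = 0 -> f = fvar * Fps (fun n => f n.+1).
Proof.
move=> f0; apply: fpsP => -[|n].
  by rewrite fcoefM0 /= mul0r.
rewrite fcoefM !big_ord_recl /= mul0r add0r mul1r subn1 /= big1 ?addr0 //.
by move=> i _; rewrite mul0r.
Qed.

Lemma fdivK f g : (exists h, h * g = f) -> fdiv f g * g = f.
Proof. by move=> ex; have := @xgetPex _ 0 [set h | h * g = f]%classic ex. Qed.

End FpsRing.

Arguments fvar {K}.

Section FpsField.
Variable K : fieldType.
Implicit Types f g h : fps K.

Lemma fmulIf g : g != 0 -> injective (fun h => h * g).
Proof.
move=> gn0 h1 h2 /eqP; rewrite -subr_eq0 -mulrBl => /eqP hg0.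
apply/eqP; rewrite -subr_eq0; apply/eqP; move: (h1 - h2) hg0 => h hg0 {h1 h2}.
have exv : exists v, g v != 0.
  apply: contrapT => nex; case/negP: gn0; apply/eqP; apply: fpsP => n.
  by apply/eqP; apply/negPn/negP => gn; apply: nex; exists n.
case: (ex_minnP exv) => v gv minv.
apply: fpsP => n; elim/ltn_ind: n => n IHn.
have := congr1 (fun f : fps K => f (n + v)%N) hg0.
rewrite fcoefM.
have ltn : (n < (n + v).+1)%N by rewrite ltnS leq_addr.
rewrite (bigD1 (Ordinal ltn)) //= addKn big1 ?addr0.
  by move/eqP; rewrite mulf_eq0 (negbTE gv) orbF => /eqP.
move=> i ine; have [lin|lni|ein] := ltngtP i n.
- by rewrite IHn // mul0r.
- suff -> : g (n + v - i)%N = 0 by rewrite mulr0.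
  apply/eqP/negPn/negP => /minv; rewrite leqNgt => /negP; apply.
  by rewrite ltn_subLR ?ltn_add2r // -ltnS ltn_ord.
- by case/eqP: ine; apply: val_inj.
Qed.

Fixpoint finv_seq g n : seq K :=
  if n is m.+1 then
    rcons (finv_seq g m)
      (((m == 0%N)%:R - \sum_(i < m) (finv_seq g m)`_i * g (m - i)%N) / g 0%N)
  else [::].

Lemma fps_inv_ex g : g 0%N != 0 -> exists h, h * g = 1.
Proof.
move=> g0; exists (Fps (fun n => (finv_seq g n.+1)`_n)).
have sz n : size (finv_seq g n) = n.
  by elim: n => //= n IHn; rewrite size_rcons IHn.
have nthE n i : (i < n)%N -> (finv_seq g n)`_i = (finv_seq g i.+1)`_i.
  elim: n => // n IHn; rewrite ltnS leq_eqVlt => /orP[/eqP->//|lin].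
  by rewrite -IHn //= nth_rcons sz lin.
apply: fpsP => n; rewrite fcoefM big_ord_recr /= subnn.
rewrite nth_rcons sz ltnn eqxx divfK //.
under eq_bigr => i _ do rewrite -/(finv_seq g i.+1) -(nthE n) //.
by rewrite addrC subrK.
Qed.

End FpsField.

Section Numbers.
Variable K : numFieldType.

(* e^{ct} *)
Definition fexp (c : K) : fps K := Fps (fun n => c ^+ n / n`!%:R).

(* Li_k, as a power series without constant term. *)
Definition polylog (k : int) : fps K :=
  Fps (fun m => if m == 0%N then 0 else (m%:R ^ k)^-1).

(* t^r / \prod_j (e^{a_j t} - 1) *)
Definition barnes_gf (r : nat) (a : 'I_r -> K) : fps K :=
  fdiv (fvar ^+ r) (\prod_(j < r) (fexp (a j) - 1)).

(* Li_k(1 - e^{-t}) / (1 - e^{-t}) *)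
Definition polyB_gf (k : int) : fps K :=
  fdiv (fcomp (polylog k) (1 - fexp (-1))) (1 - fexp (-1)).

(* The numbers c_n with f = \sum_n c_n t^n / n!. *)
Definition egf_coef (f : fps K) (n : nat) : K := n`!%:R * f n.

(* S_n^{(r,k)}(x | a_1, ..., a_r) *)
Definition mixed_poly (r : nat) (k : int) (a : 'I_r -> K) (n : nat) (x : K) : K :=
  egf_coef (barnes_gf a * polyB_gf k * fexp x) n.

(* B_n^{(k)}(x) *)
Definition polyB (k : int) (n : nat) (x : K) : K :=
  egf_coef (polyB_gf k * fexp x) n.

(* B_n(x | a_1, ..., a_r) *)
Definition barnes (r : nat) (a : 'I_r -> K) (n : nat) (x : K) : K :=
  egf_coef (barnes_gf a * fexp x) n.

(* S_2(l, m), from (e^t - 1)^m = m! \sum_l S_2(l, m) t^l / l!. *)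
Definition stirling2 (l m : nat) : K :=
  egf_coef ((fexp 1 - 1) ^+ m) l / m`!%:R.

Lemma fexp_coef0 c : fexp c 0%N = 1.
Proof. by rewrite /= fact0 divr1. Qed.

Lemma barnes_gfP (r : nat) (a : 'I_r -> K) : (forall j, a j != 0) ->
  barnes_gf a * \prod_(j < r) (fexp (a j) - 1) = fvar ^+ r.
Proof.
move=> a0; apply: fdivK.
pose u j : fps K := Fps (fun n => (fexp (a j) - 1) n.+1).
have uE j : fexp (a j) - 1 = fvar * u j.
  by apply: fvar_dvd; rewrite fcoefD fcoefN fexp_coef0 fcoef1 subrr.
have u0 : (\prod_(j < r) u j) 0%N != 0.
  have -> : (\prod_(j < r) u j) 0%N = \prod_(j < r) u j 0%N.
    by elim/big_ind2: _ => // _ f _ g <- <-; rewrite fcoefM0.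
  apply/prodf_neq0 => j _ /=.
  by rewrite /= subr0 divr1 expr1.
have [h hu] := fps_inv_ex u0; exists h.
under eq_bigr do rewrite uE.
by rewrite big_split /= prodr_const card_ord mulrCA hu mulr1.
Qed.

Lemma polyB_gfP (k : int) :
  polyB_gf k * (1 - fexp (-1)) = fcomp (polylog k) (1 - fexp (-1)).
Proof.
apply: fdivK.
set w := 1 - fexp (-1).
have wE : w = fvar * Fps (fun n => w n.+1).
  by apply: fvar_dvd; rewrite fcoefD fcoefN fexp_coef0 fcoef1 subrr.
have u0 : Fps (fun n => w n.+1) 0%N != 0.
  by rewrite /= divr1 expr1 add0r opprK oner_eq0.
have fE : fcomp (polylog k) w
    = fvar * Fps (fun n => fcomp (polylog k) w n.+1).
  by apply: fvar_dvd; rewrite /= big_ord1 mul0r.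
have [h hu] := fps_inv_ex u0.
exists (h * Fps (fun n => fcomp (polylog k) w n.+1)).
move: fE; set f := fcomp _ _ => fE.
by rewrite [RHS]fE [X in _ * X]wE mulrCA mulrAC hu mul1r.
Qed.

End Numbers.

(* Main.v *)
Require Import Defs.
From HB Require Import structures.
From mathcomp Require Import all_boot all_order all_algebra.
From mathcomp Require Import boolp classical_sets reals complex.
From mathcomp Require Import ring.

Set Implicit Arguments.
Unset Strict Implicit.
Unset Printing Implicit Defensive.

Import Order.TTheory GRing.Theory Num.Theory.
Local Open Scope ring_scope.

(** The generating function of the mixed-type polynomials is the product of the
    Barnes factor, the poly-Bernoulli factor and [e^{xt}], so the first, second
    and last expansions are binomial convolutions.  The other two use
    [Li_k(w) / w = \sum_m w^m / (m+1)^k] at [w = 1 - e^{-t}]: the third expands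
    [w^m e^{xt}] by the binomial theorem into the exponentials [e^{(x-j)t}],
    and the fourth reads off Stirling numbers, since [w] is obtained from
    [e^t - 1] by [t |-> -t] and a change of sign. *)

(** Both sides run over the triangle l <= j <= n; the swap collects the powers of [x] in the
    Stirling expansion. *)
Lemma exchange_triangle (V : nmodType) n (F : nat -> nat -> V) :
  \sum_(0 <= j < n.+1) \sum_(0 <= l < j.+1) F j l =
  \sum_(0 <= l < n.+1) \sum_(l <= j < n.+1) F j l.
Proof.
under eq_big_nat => j /andP[_ lt_jn] do rewrite (big_nat_widen _ _ n.+1) //.
rewrite (exchange_big_dep_nat predT) //=.
by apply: eq_bigr => l _; rewrite [RHS](big_nat_widenl _ 0).
Qed.

(** * Coefficients of powers and compositions of power series *)

Section FpsCoefficients.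
Variable K : comNzRingType.
Implicit Types f g w : fps K.

Lemma fcoef_sum (I : Type) (s : seq I) (P : pred I) (F : I -> fps K) n :
  (\sum_(i <- s | P i) F i) n = \sum_(i <- s | P i) F i n.
Proof. by apply: (big_morph (fun f : fps K => f n)). Qed.

Lemma fcoefMn f p n : (f *+ p) n = f n *+ p.
Proof. by elim: p => [|p IHp]; rewrite ?mulr0n // !mulrS fcoefD IHp. Qed.

Lemma fcoef_sign f j n : ((-1) ^+ j * f) n = (-1) ^+ j * f n.
Proof.
by elim: j => [|j IHj]; rewrite ?mul1r // !exprS !mulN1r !mulNr fcoefN IHj.
Qed.

(** A series divisible by t has its m-th power divisible by t^m. *)
Lemma fcoefX_lt w m n : w 0%N = 0 -> (n < m)%N -> (w ^+ m) n = 0.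
Proof.
move=> w0; elim: m n => // m IHm n; rewrite ltnS => le_nm.
rewrite exprS fcoefM big_ord_recl w0 mul0r add0r big1 // => i _ /=.
rewrite IHm ?mulr0 //= /bump /=; apply: leq_trans le_nm.
by rewrite ltn_subrL (leq_ltn_trans _ (ltn_ord i)).
Qed.

(** The terms with n < m <= N vanish by [fcoefX_lt]. A cutoff independent of [n] serves all
    coefficients up to [N] at once, so finite sums can be exchanged. *)
Lemma fcoef_comp f w N n : w 0%N = 0 -> (n <= N)%N ->
  fcomp f w n = \sum_(m < N.+1) f m * (w ^+ m) n.
Proof.
move=> w0 le_nN /=.
rewrite (big_ord_widen N.+1 (fun m => f m * (w ^+ m) n)) //.
rewrite [RHS](bigID (fun m : 'I_N.+1 => (m < n.+1)%N)) /= [X in _ + X]big1.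
  by rewrite addr0.
by move=> i; rewrite -leqNgt => lt_ni; rewrite fcoefX_lt ?mulr0.
Qed.

Lemma fcoef_compM f w g N n : w 0%N = 0 -> (n <= N)%N ->
  (fcomp f w * g) n = \sum_(m < N.+1) f m * (w ^+ m * g) n.
Proof.
move=> w0 le_nN; rewrite fcoefM.
under eq_bigr => i _.
  rewrite (@fcoef_comp f w N) //; last by rewrite (leq_trans _ le_nN) // -ltnS.
  rewrite mulr_suml; over.
rewrite exchange_big; apply: eq_bigr => m _.
by rewrite fcoefM mulr_sumr; apply: eq_bigr => i _; rewrite mulrA.
Qed.

(** If f(t) = t g(t), then f(w) = g(w) w; this will identify Li_k(w) / w. *)
Lemma fcompMr f w : w 0%N = 0 -> f 0%N = 0 ->
  fcomp (Fps (fun m => f m.+1)) w * w = fcomp f w.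
Proof.
move=> w0 f0; apply: fpsP => n; rewrite (@fcoef_compM _ _ _ n) //.
(* The cutoff [n.+1] leaves exactly the shifted indices 0..n once the zero term m = 0 is dropped. *)
rewrite (@fcoef_comp f w n.+1) // [RHS]big_ord_recl f0 mul0r add0r.
by apply: eq_bigr => m _; rewrite -exprSr.
Qed.

(* [f(t) = b g(ct)] implies [f(t)^m = b^m g(ct)^m]. *)
Lemma fcoefX_rescale b c f g m n : (forall i, f i = b * c ^+ i * g i) ->
  (f ^+ m) n = b ^+ m * c ^+ n * (g ^+ m) n.
Proof.
move=> fg; elim: m n => [|m IHm] n.
  by rewrite !expr0 mul1r fcoef1; case: n => [|n]; rewrite ?mulr1 ?mulr0.
rewrite !(exprS _ m) !fcoefM mulr_sumr; apply: eq_bigr => i _.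
have -> : c ^+ n = c ^+ i * c ^+ (n - i) by rewrite -exprD subnKC // -ltnS.
by rewrite fg IHm; ring.
Qed.

End FpsCoefficients.

(** * Exponential generating functions and the poly-Bernoulli series *)

Section MixedType.
Variable K : numFieldType.
Implicit Types (f g : fps K) (x y : K) (k : int).

Lemma egf_coefM f g n : egf_coef (f * g) n =
  \sum_(0 <= l < n.+1) 'C(n, l)%:R * egf_coef f (n - l)%N * egf_coef g l.
Proof.
(* Commuting the factors puts the summation index on [g], as in the statement. *)
rewrite mulrC /egf_coef fcoefM mulr_sumr big_mkord; apply: eq_bigr => l _.
have le_ln : (l <= n)%N by rewrite -ltnS.
rewrite -(bin_fact le_ln) !natrM -!mulrA; congr (_ * _).
by rewrite [g l * _]mulrC !(mulrCA _ (l`!%:R)).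
Qed.

Lemma egf_coef_exp x n : egf_coef (fexp x) n = x ^+ n.
Proof. by rewrite /egf_coef /= mulrC divfK // pnatr_eq0 -lt0n fact_gt0. Qed.

Lemma egf_coef_inj f g : egf_coef f =1 egf_coef g -> f = g.
Proof.
move=> fg; apply: fpsP => n; apply: (@mulfI K n`!%:R); last exact: fg.
by rewrite pnatr_eq0 -lt0n fact_gt0.
Qed.

Lemma fexpD x y : fexp x * fexp y = fexp (x + y).
Proof.
apply: egf_coef_inj => n; rewrite egf_coefM egf_coef_exp exprDn big_mkord.
by apply: eq_bigr => i _; rewrite !egf_coef_exp -mulrA mulr_natl.
Qed.

Lemma fexp0 : fexp 0 = 1 :> fps K.
Proof.
by apply: fpsP => -[|n]; rewrite /= ?expr0 ?fact0 ?divr1 // expr0n mul0r.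
Qed.

Lemma fexpX x m : fexp x ^+ m = fexp (x *+ m).
Proof.
by elim: m => [|m IHm]; rewrite ?mulr0n ?fexp0 // exprS IHm fexpD mulrS.
Qed.

Definition one_sub_exp : fps K := 1 - fexp (-1).

Lemma one_sub_exp0 : one_sub_exp 0%N = 0.
Proof. by rewrite fcoefD fcoefN fexp_coef0 fcoef1 subrr. Qed.

(** [polyB_gf] is a chosen quotient; cancelling the nonzero factor [one_sub_exp] identifies it with
    an explicit composition. *)
Lemma polyB_gfE k :
  polyB_gf K k = fcomp (Fps (fun m => polylog K k m.+1)) one_sub_exp.
Proof.
apply: (@fmulIf K one_sub_exp).
  (* The coefficient of t in 1 - e^{-t} is 1. *)
  apply/eqP => /(congr1 (fun f : fps K => f 1%N)) /=.
  by rewrite divr1 expr1 add0r opprK => /eqP; rewrite oner_eq0.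
by rewrite polyB_gfP fcompMr // one_sub_exp0.
Qed.

Lemma one_sub_expX_exp m x l : egf_coef (one_sub_exp ^+ m * fexp x) l =
  \sum_(0 <= j < m.+1) (-1) ^+ j * 'C(m, j)%:R * (x - j%:R) ^+ l.
Proof.
rewrite /one_sub_exp exprBn mulr_suml /egf_coef fcoef_sum mulr_sumr big_mkord.
apply: eq_bigr => j _.
rewrite expr1n mulr1 [_ *+ _ * fexp x]mulrnAl -[_ * fexp x]mulrA.
rewrite fexpX fexpD fcoefMn fcoef_sign.
rewrite mulNrn [_ + x]addrC -[(x - _) ^+ l]egf_coef_exp /egf_coef.
by rewrite -mulr_natr; ring.
Qed.

(** Rescaling e^t - 1 with b = c = -1 gives the sign (-1)^(m+n), which has the parity of n - m. *)
Lemma egf_coef_one_sub_expX m n : (m <= n)%N ->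
  egf_coef (one_sub_exp ^+ m) n = (-1) ^+ (n - m) * m`!%:R * stirling2 K n m.
Proof.
move=> le_mn; rewrite /stirling2 /egf_coef.
rewrite (@fcoefX_rescale _ (-1) (-1) _ (fexp 1 - 1)) => [|i].
  (* Write m + n = 2m + (n - m); this needs m <= n, as subtraction is truncated. *)
  rewrite -exprD -[X in (-1) ^+ (m + X)](subnKC le_mn) addnA addnn.
  rewrite -signr_odd oddD odd_double signr_odd -!mulrA mulrCA.
  congr (_ * _); rewrite [RHS]mulrC -!mulrA [_^-1 * _]mulVf ?mulr1 //.
  by rewrite pnatr_eq0 -lt0n fact_gt0.
rewrite fcoefD fcoefN fcoef1 fcoefD fcoefN fcoef1 /= expr1n mulrBr.
by case: i => [|i] /=; ring.
Qed.

(** Any cutoff [N] at least [l] works, so the range of [m] can be made the same for all [l]. *)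
Lemma polyB_sum_exp k N l x : (l <= N)%N -> polyB k l x =
  \sum_(0 <= m < N.+1) \sum_(0 <= j < m.+1)
    (-1) ^+ j * 'C(m, j)%:R * (1 / m.+1%:R ^ k) * (x - j%:R) ^+ l.
Proof.
move=> le_lN; rewrite /polyB polyB_gfE /egf_coef.
rewrite (@fcoef_compM _ _ _ _ N) ?one_sub_exp0 // mulr_sumr big_mkord.
apply: eq_bigr => m _; rewrite mulrCA -/(egf_coef _ _) one_sub_expX_exp mulr_sumr.
by apply: eq_bigr => j _; rewrite /= div1r mulrCA mulrA.
Qed.

Lemma polyB_stirling2 k n : polyB k n 0 =
  \sum_(0 <= m < n.+1)
    (-1) ^+ (n - m) * (m`!%:R / m.+1%:R ^ k) * stirling2 K n m.
Proof.
rewrite /polyB fexp0 mulr1 polyB_gfE /egf_coef.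
rewrite (@fcoef_comp _ _ _ n) ?one_sub_exp0 // mulr_sumr big_mkord.
apply: eq_bigr => m _; rewrite mulrCA -/(egf_coef _ _).
rewrite egf_coef_one_sub_expX; last by rewrite -ltnS.
by rewrite /= mulrCA !mulrA; congr (_ * _); rewrite mulrC mulrA mulrAC.
Qed.

(** * The five expansions *)

Section Expansions.
Variables (r : nat) (k : int) (a : 'I_r -> K).

Lemma barnes_expand n x : barnes a n x =
  \sum_(0 <= l < n.+1) 'C(n, l)%:R * barnes a (n - l)%N 0 * x ^+ l.
Proof.
rewrite {1}/barnes egf_coefM; apply: eq_bigr => l _.
by rewrite egf_coef_exp /barnes fexp0 mulr1.
Qed.

Lemma mixed_poly_barnes_polyB n x : mixed_poly k a n x =
  \sum_(0 <= l < n.+1) 'C(n, l)%:R * barnes a (n - l)%N 0 * polyB k l x.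
Proof.
rewrite /mixed_poly -mulrA egf_coefM; apply: eq_bigr => l _.
by rewrite /barnes fexp0 mulr1.
Qed.

Lemma mixed_poly_polyB_barnes n x : mixed_poly k a n x =
  \sum_(0 <= l < n.+1) 'C(n, l)%:R * polyB k (n - l)%N 0 * barnes a l x.
Proof.
(* Here e^{xt} is attached to the Barnes factor instead of the poly-Bernoulli one. *)
rewrite /mixed_poly [barnes_gf a * _]mulrC -mulrA egf_coefM.
by apply: eq_bigr => l _; rewrite /polyB fexp0 mulr1.
Qed.

Lemma mixed_poly_shifted_powers n x : mixed_poly k a n x =
  \sum_(0 <= l < n.+1) \sum_(0 <= m < n.+1) \sum_(0 <= j < m.+1)
    (-1) ^+ j * 'C(m, j)%:R * 'C(n, l)%:R * (1 / m.+1%:R ^ k)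
    * barnes a (n - l)%N 0 * (x - j%:R) ^+ l.
Proof.
rewrite mixed_poly_barnes_polyB; apply: eq_big_nat => l /andP[_ lt_ln].
rewrite (@polyB_sum_exp _ n) // mulr_sumr; apply: eq_bigr => m _.
rewrite mulr_sumr; apply: eq_bigr => j _.
rewrite mulrA; congr (_ * _).
by rewrite [LHS]mulrC mulrA; congr (_ * _); rewrite mulrAC.
Qed.

Lemma mixed_poly_stirling2 n x : mixed_poly k a n x =
  \sum_(0 <= l < n.+1)
    (\sum_(l <= j < n.+1) \sum_(0 <= m < (n - j).+1)
       (-1) ^+ (n - m - j)%N * 'C(n, j)%:R * 'C(j, l)%:R
       * (m`!%:R / m.+1%:R ^ k) * stirling2 K (n - j)%N m
       * barnes a (j - l)%N 0) * x ^+ l.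
Proof.
rewrite mixed_poly_polyB_barnes.
under eq_bigr => j _ do rewrite barnes_expand mulr_sumr.
rewrite exchange_triangle; apply: eq_bigr => l _.
rewrite mulr_suml; apply: eq_bigr => j _.
rewrite polyB_stirling2 mulr_sumr !mulr_suml; apply: eq_bigr => m _.
(* The sign exponent [n - j - m] from [polyB_stirling2] is reordered to [n - m - j]. *)
by rewrite subnAC; ring.
Qed.

Lemma mixed_poly_expand n x : mixed_poly k a n x =
  \sum_(0 <= j < n.+1) 'C(n, j)%:R * mixed_poly k a (n - j)%N 0 * x ^+ j.
Proof.
rewrite {1}/mixed_poly egf_coefM; apply: eq_bigr => j _.
by rewrite egf_coef_exp /mixed_poly fexp0 mulr1.
Qed.

End Expansions.

End MixedType.

Theorem theorem1 (R : realType) (r : nat) (k : int) (a : 'I_r -> R[i])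
    (r_gt0 : (0 < r)%N) (a_neq0 : forall j, a j != 0) (n : nat) (x : R[i]) :
  [/\ mixed_poly k a n x
      = \sum_(0 <= l < n.+1) 'C(n, l)%:R * barnes a (n - l)%N 0 * polyB k l x,
      mixed_poly k a n x
      = \sum_(0 <= l < n.+1) 'C(n, l)%:R * polyB k (n - l)%N 0 * barnes a l x,
      mixed_poly k a n x
      = \sum_(0 <= l < n.+1) \sum_(0 <= m < n.+1) \sum_(0 <= j < m.+1)
          (-1) ^+ j * 'C(m, j)%:R * 'C(n, l)%:R * (1 / m.+1%:R ^ k)
          * barnes a (n - l)%N 0 * (x - j%:R) ^+ l,
      mixed_poly k a n x
      = \sum_(0 <= l < n.+1)
          (\sum_(l <= j < n.+1) \sum_(0 <= m < (n - j).+1)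
             (-1) ^+ (n - m - j)%N * 'C(n, j)%:R * 'C(j, l)%:R
             * (m`!%:R / m.+1%:R ^ k) * stirling2 R[i] (n - j)%N m
             * barnes a (j - l)%N 0) * x ^+ l
    & mixed_poly k a n x
      = \sum_(0 <= j < n.+1) 'C(n, j)%:R * mixed_poly k a (n - j)%N 0 * x ^+ j].
Proof.
split.
- exact: mixed_poly_barnes_polyB.
- exact: mixed_poly_polyB_barnes.
- exact: mixed_poly_shifted_powers.
- exact: mixed_poly_stirling2.
- exact: mixed_poly_expand.
Qed.
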